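(* Let $c$ be a fixed constant. The \textsc{Min-TSS} problem restricted to instances whose thresholds are all at most $c$ is polynomial-time reducible to the \textsc{Min-Key} problem.
   Context: \textsc{Min-TSS}: given an undirected graph $G=(V,E)$ and thresholds $t:V\to\mathbb{Z}_+$, find a target set of minimum size, where a set $S\subseteq V$ is a target set if, starting with the vertices of $S$ active and in each round activating every vertex $v$ having at least $t(v)$ active neighbors, eventually all vertices become active. \textsc{Min-Key}: given a pure Horn CNF $\Phi$ over variable set $V$ (a conjunction of implications $A\to v$, $A\subseteq V$, $v\in V$, meaning $v\vee\bigvee_{a\in A}\bar a$), find a key of minimum size, where $K\subseteq V$ is a key if $K\to u$ is implied by $\Phi$ for all $u\in V\setminus K$ (equivalently, forward chaining from $K$ using the clauses of $\Phi$ reaches all of $V$). Here a polynomial-time reduction from problem $P$ to problem $Q$ means a polynomial-time transformation of each instance $I$ of $P$ into an instance $I'$ of $Q$ with the same optimum value, together with a polynomial-time procedure converting any feasible solution of $I'$ into a feasible solution of $I$ of no larger size. *)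

(* Defs.v *)
From mathcomp Require Import all_boot.

Set Implicit Arguments.
Unset Strict Implicit.
Unset Printing Implicit Defensive.

(* Deterministic multi-tape Turing machines with [bool] as input and output   *)
(* alphabet.  A tape symbol is blank ([None]), a bit, or one of finitely many *)
(* auxiliary symbols.                                                         *)

Inductive move := MoveLeft | Stay | MoveRight.

Definition symbol (G : finType) : Type := option (bool + G).

(* There are [tm_last.+1] tapes: the input is on tape [ord0], the output on   *)
(* tape [ord_max].                                                            *)
Record turing_machine := TuringMachine {
  tm_state : finType;
  tm_aux : finType;
  tm_last : nat;
  tm_start : tm_state;
  tm_halt : pred tm_state;
  tm_delta : tm_state -> {ffun 'I_tm_last.+1 -> symbol tm_aux} ->
             tm_state * {ffun 'I_tm_last.+1 -> symbol tm_aux * move} }.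

(* A two-way infinite tape; cells that are not listed are blank, and          *)
(* [tape_left] lists the cells left of the head from nearest to farthest.     *)
Record tape (S : Type) := Tape {
  tape_left : seq (option S);
  tape_head : option S;
  tape_right : seq (option S) }.

Definition tape_move (S : Type) (d : move) (t : tape S) : tape S :=
  let: Tape l x r := t in
  match d with
  | MoveLeft => Tape (behead l) (head None l) (x :: r)
  | Stay => t
  | MoveRight => Tape (x :: l) (head None r) (behead r)
  end.

Definition tape_write (S : Type) (x : option S) (t : tape S) : tape S :=
  Tape (tape_left t) x (tape_right t).

Section Run.
Variable M : turing_machine.

Definition config : Type :=
  (tm_state M * {ffun 'I_(tm_last M).+1 -> tape (bool + tm_aux M)})%type.

Definition tm_step (c : config) : config :=
  let: (q, t) := c in
  if tm_halt q then c else
  let: (q', a) := tm_delta q [ffun i => tape_head (t i)] in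
  (q', [ffun i => tape_move (a i).2 (tape_write (a i).1 (t i))]).

Definition input_tape (w : seq bool) : tape (bool + tm_aux M) :=
  let s := [seq Some (inl b) | b <- w] in Tape [::] (head None s) (behead s).

Definition tm_init (w : seq bool) : config :=
  (tm_start M, [ffun i => input_tape (if i == ord0 then w else [::])]).

Fixpoint read_bits (s : seq (symbol (tm_aux M))) : seq bool :=
  if s is Some (inl b) :: s' then b :: read_bits s' else [::].

(* The output is the maximal word of bits that starts at the head. *)
Definition tm_output (c : config) : seq bool :=
  let t := c.2 ord_max in read_bits (tape_head t :: tape_right t).

(* Halted configurations are fixed by [tm_step], so the machine is required   *)
(* to halt in at most [T] steps.                                              *)
Definition tm_computes_in (T : nat) (w w' : seq bool) : Prop :=
  let c := iter T tm_step (tm_init w) in tm_halt c.1 /\ tm_output c = w'.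

End Run.

(* A single machine maps [src x] to [dst x], for all [x : X], in time         *)
(* polynomial in the length of [src x].                                       *)
Definition poly_time (X : Type) (src dst : X -> seq bool) : Prop :=
  exists (M : turing_machine) (a d : nat), forall x : X,
    tm_computes_in M (a * size (src x) ^ d + a) (src x) (dst x).

Definition pair_code (u v : seq bool) : seq bool :=
  flatten [seq [:: true; b] | b <- u] ++ false :: v.

Record min_problem := MinProblem {
  instance : Type;
  solution : instance -> Type;
  feasible : forall I : instance, solution I -> Prop;
  cost : forall I : instance, solution I -> nat;
  instance_code : instance -> seq bool;
  solution_code : forall I : instance, solution I -> seq bool }.

Arguments solution {m} _.
Arguments feasible {m I} _.
Arguments cost {m I} _.
Arguments instance_code {m} _.
Arguments solution_code {m I} _.

Definition optimum (P : min_problem) (I : instance P) (k : nat) : Prop :=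
  (exists2 s : solution I, feasible s & cost s = k) /\
  (forall s : solution I, feasible s -> k <= cost s).

Definition restrict (P : min_problem) (p : instance P -> Prop) : min_problem :=
  {| instance := {I : instance P | p I};
     solution := fun I => solution (sval I);
     feasible := fun I s => feasible s;
     cost := fun I s => cost s;
     instance_code := fun I => instance_code (sval I);
     solution_code := fun I s => solution_code s |}.

(* The procedure converting solutions is given both the instance [I] of [P]   *)
(* and a feasible solution of the instance [f I] of [Q]; nothing is required  *)
(* of it on infeasible solutions.                                             *)
Definition poly_reducible (P Q : min_problem) : Prop :=
  exists (f : instance P -> instance Q)
         (g : forall I : instance P, solution (f I) -> solution I),
  [/\ poly_time (fun I : instance P => instance_code I)
                (fun I : instance P => instance_code (f I)),
      forall (I : instance P) (k : nat), optimum I k <-> optimum (f I) k,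
      poly_time
        (fun z : {I : instance P & {s : solution (f I) | feasible s}} =>
           pair_code (instance_code (tag z)) (solution_code (sval (tagged z))))
        (fun z : {I : instance P & {s : solution (f I) | feasible s}} =>
           solution_code (g (tag z) (sval (tagged z))))
    & forall (I : instance P) (s : solution (f I)), feasible s ->
        feasible (g I s) /\ cost (g I s) <= cost s].

(* Numbers are coded in unary.  Compared with binary this only changes the    *)
(* length of a code polynomially here, since vertices and variables are       *)
(* listed explicitly and thresholds will be bounded by a constant.            *)
Definition nat_code (n : nat) : seq bool := rcons (nseq n true) false.

Definition set_code (n : nat) (A : {set 'I_n}) : seq bool :=
  [seq i \in A | i <- enum 'I_n].

Record tss_instance := TssInstance {
  tss_order : nat;
  tss_adj : rel 'I_tss_order;
  tss_sym : symmetric tss_adj;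
  tss_irr : irreflexive tss_adj;
  tss_threshold : 'I_tss_order -> nat }.

Section TargetSet.
Variable I : tss_instance.

Definition tss_neighbors (v : 'I_(tss_order I)) : {set 'I_(tss_order I)} :=
  [set u | tss_adj v u].

Definition activate (A : {set 'I_(tss_order I)}) : {set 'I_(tss_order I)} :=
  A :|: [set v | tss_threshold v <= #|tss_neighbors v :&: A|].

Definition target_set (S : {set 'I_(tss_order I)}) : Prop :=
  exists k : nat, iter k activate S = [set: 'I_(tss_order I)].

Definition tss_code : seq bool :=
  nat_code (tss_order I) ++
  flatten [seq set_code (tss_neighbors v) ++ nat_code (tss_threshold v)
          | v <- enum 'I_(tss_order I)].

End TargetSet.

Definition min_TSS : min_problem :=
  {| instance := tss_instance;
     solution := fun I => {set 'I_(tss_order I)};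
     feasible := @target_set;
     cost := fun I S => #|S|;
     instance_code := tss_code;
     solution_code := fun I => @set_code (tss_order I) |}.

Definition thresholds_at_most (c : nat) (I : tss_instance) : Prop :=
  forall v : 'I_(tss_order I), tss_threshold v <= c.

(* The implication [A -> v] is represented by the pair [(A, v)]. *)
Definition horn_clause (n : nat) : Type := ({set 'I_n} * 'I_n)%type.

Record horn_cnf := HornCnf {
  horn_order : nat;
  horn_clauses : seq (horn_clause horn_order) }.

Definition satisfies_clause (n : nat) (x : 'I_n -> bool) (C : horn_clause n) :=
  x C.2 || [exists a in C.1, ~~ x a].

Section Key.
Variable Phi : horn_cnf.

Definition satisfies (x : 'I_(horn_order Phi) -> bool) : bool :=
  all (satisfies_clause x) (horn_clauses Phi).

Definition implied (C : horn_clause (horn_order Phi)) : Prop :=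
  forall x : 'I_(horn_order Phi) -> bool, satisfies x -> satisfies_clause x C.

Definition key (K : {set 'I_(horn_order Phi)}) : Prop :=
  forall u : 'I_(horn_order Phi), u \notin K -> implied (K, u).

Definition horn_code : seq bool :=
  nat_code (horn_order Phi) ++
  flatten [seq true :: set_code C.1 ++ nat_code (val C.2)
          | C : horn_clause _ <- horn_clauses Phi] ++
  [:: false].

End Key.

Definition min_Key : min_problem :=
  {| instance := horn_cnf;
     solution := fun Phi => {set 'I_(horn_order Phi)};
     feasible := @key;
     cost := fun Phi K => #|K|;
     instance_code := horn_code;
     solution_code := fun Phi => @set_code (horn_order Phi) |}.

(* Main.v *)
Require Import Defs.
From mathcomp Require Import all_boot zify.

Set Implicit Arguments.
Unset Strict Implicit.
Unset Printing Implicit Defensive.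

(* The Horn formula has the vertices as variables and all clauses [A -> v]    *)
(* with [A] a set of neighbors of [v] of the form [W :&: N(v)], where         *)
(* [#|A| >= t(v)] and [W] ranges over a family of polynomially many sets that *)
(* contains all sets of at most [c] vertices.  Forward chaining is then the   *)
(* activation process, so keys and target sets coincide and solutions need no *)
(* conversion.  The family consists of the sets whose indicator words are the *)
(* first [n] bits of [0^{j_1} 1 ... 0^{j_i} 1 0^n] with [i <= c] and all      *)
(* [j_r < n]; it is enumerated by [c] nested loops that keep the word on a    *)
(* stack.  The Turing machines are compiled from structured programs acting   *)
(* on finitely many stacks of bits, one stack per tape.                       *)

(** * Stack programs *)

(** Soundness: chaining with a clause [A -> v], where [A] consists of at least t(v) neighbors of
    [v], never leaves the activation closure. Completeness: a vertex that becomes active has t(v)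
    active neighbors, and any t(v) of them form the body of a clause, because t(v) <= c and the
    family of masks contains every set of at most [c] vertices. This is [key_target_set]; it makes
    the optimum values agree and lets the identity convert solutions. The list [words] has (n+1)^c
    entries, which is polynomial because [c] is fixed.

    The rest is a cost analysis on machines. [iter_embed] yields the running times of the program
    combinators, [compiled_computes] turns a stack program into a Turing machine at most twice as
    slow, and [poly_time_runs] passes to [poly_time]. The nested loops are analysed in [runs_gen]
    and the whole reduction in [runs_reduce]; [horn_code_tss] identifies the word produced with the
    code of the formula. *)

Notation store := (seq (seq bool)).

Section StackPrograms.
Variable K : nat.
Local Notation reg := 'I_K.+1.

Definition get (s : store) (i : reg) : seq bool := nth [::] s i.
Definition upd (s : store) (i : reg) (l : seq bool) : store := set_nth [::] s i l.

(* [Some (i, None)] pops register [i], [Some (i, Some b)] pushes [b] on it. *)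
Definition action : Type := option (reg * option bool).

Definition act (a : action) (s : store) : store :=
  match a with
  | None => s
  | Some (i, None) => upd s i (behead (get s i))
  | Some (i, Some b) => upd s i (b :: get s i)
  end.

Definition tops (s : store) : {ffun reg -> option bool} :=
  [ffun i => ohead (get s i)].

(* The successor state [None] is the exit. *)
Record prog := Prog {
  pstate : finType;
  pstart : pstate;
  pdelta : pstate -> {ffun reg -> option bool} -> option pstate * action }.

Definition pstep (p : prog) (c : option (pstate p) * store) :=
  if c is (Some q, s) then
    let: (o, a) := pdelta q (tops s) in (o, act a s)
  else c.

(** Time is an upper bound, so that branches of different cost share one estimate. *)
Definition runs (p : prog) (s s' : store) (t : nat) : Prop :=
  exists2 t', t' <= t & iter t' (@pstep p) (Some (pstart p), s) = (None, s').

Lemma runs_le p s s' t t' : runs p s s' t -> t <= t' -> runs p s s' t'.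
Proof. by case=> u le_ut run le_tt'; exists u => //; apply: leq_trans le_tt'. Qed.

Definition do (a : action) : prog := @Prog unit tt (fun _ _ => (None, a)).

Definition seqp (p q : prog) : prog :=
  @Prog (pstate p + pstate q)%type (inl (pstart p)) (fun x h =>
    match x with
    | inl x => let: (o, a) := pdelta x h in
               (Some (if o is Some x' then inl x' else inr (pstart q)), a)
    | inr x => let: (o, a) := pdelta x h in (omap inr o, a)
    end).

Definition ifp (i : reg) (c : pred (option bool)) (p q : prog) : prog :=
  @Prog (option (pstate p + pstate q)) None (fun x h =>
    match x with
    | None => (Some (Some (if c (h i) then inl (pstart p) else inr (pstart q))),
               None)
    | Some (inl x) => let: (o, a) := pdelta x h in (omap (Some \o inl) o, a)
    | Some (inr x) => let: (o, a) := pdelta x h in (omap (Some \o inr) o, a)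
    end).

(** The state [None] performs the test; the exit of the body leads back to it. *)
Definition whilep (i : reg) (c : pred (option bool)) (p : prog) : prog :=
  @Prog (option (pstate p)) None (fun x h =>
    match x with
    | None => (if c (h i) then Some (Some (pstart p)) else None, None)
    | Some x => let: (o, a) := pdelta x h in (Some o, a)
    end).

Lemma iter_exit p t s : iter t (@pstep p) (None, s) = (None, s).
Proof. by elim: t => //= t ->. Qed.

(** The simulation shared by all combinators: [P] copies the transitions of [p] and redirects its
    exit to [ex]. The count [t'] stops exactly at that exit, since [P] may go on from [ex] while [p]
    idles. *)
Lemma iter_embed (p P : prog) (inj : pstate p -> pstate P)
    (ex : option (pstate P)) :
  (forall q h, pdelta (inj q) h =
     let: (o, a) := pdelta q h in (if o is Some q' then Some (inj q') else ex, a)) ->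
  forall t q s s', iter t (@pstep p) (Some q, s) = (None, s') ->
  exists2 t', t' <= t & iter t' (@pstep P) (Some (inj q), s) = (ex, s').
Proof.
move=> embed; elim=> [|t IH] q s s' //; rewrite iterSr /=.
case e: (pdelta q (tops s)) => [[q'|] a].
  case/IH=> t' le_t' run; exists t'.+1 => //.
  by rewrite iterSr /= embed e.
by rewrite iter_exit => -[<-]; exists 1 => //=; rewrite embed e.
Qed.

Lemma runs_do a s : runs (do a) s (act a s) 1.
Proof. by exists 1. Qed.

Lemma runs_seq p q s1 s2 s3 t1 t2 :
  runs p s1 s2 t1 -> runs q s2 s3 t2 -> runs (seqp p q) s1 s3 (t1 + t2).
Proof.
case=> u1 le1 run1 [u2 le2 run2].
have [|v1 lev1 r1] := @iter_embed p (seqp p q) inl (Some (inr (pstart q)))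
  _ u1 (pstart p) s1 s2 run1.
  by move=> x h /=; case: (pdelta x h) => [[x'|] a].
have [|v2 lev2 r2] := @iter_embed q (seqp p q) inr None _ u2 (pstart q) s2 s3 run2.
  by move=> x h /=; case: (pdelta x h) => [[x'|] a].
exists (v2 + v1); first by lia.
by rewrite iterD /= r1.
Qed.

Lemma runs_if i (c : pred (option bool)) p q s s' t :
  runs (if c (ohead (get s i)) then p else q) s s' t ->
  runs (ifp i c p q) s s' t.+1.
Proof.
case cs: (c _) => -[u le_u run].
  have [|v lev r] := @iter_embed p (ifp i c p q) (Some \o inl) None
    _ u (pstart p) s s' run.
    by move=> x h /=; case: (pdelta x h) => [[x'|] a].
  by exists v.+1; [lia | rewrite iterSr]; rewrite /= ffunE cs.
have [|v lev r] := @iter_embed q (ifp i c p q) (Some \o inr) None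
  _ u (pstart q) s s' run.
  by move=> x h /=; case: (pdelta x h) => [[x'|] a].
by exists v.+1; [lia | rewrite iterSr]; rewrite /= ffunE cs.
Qed.

Lemma runs_while_exit i (c : pred (option bool)) p s :
  ~~ c (ohead (get s i)) -> runs (whilep i c p) s s 1.
Proof. by move=> /negbTE cs; exists 1 => //=; rewrite ffunE cs. Qed.

Lemma runs_while_loop i (c : pred (option bool)) p s1 s2 s3 t1 t2 :
  c (ohead (get s1 i)) -> runs p s1 s2 t1 -> runs (whilep i c p) s2 s3 t2 ->
  runs (whilep i c p) s1 s3 (t1 + t2).+1.
Proof.
move=> cs [u1 le1 run1] [u2 le2 run2].
have [|v1 lev1 r1] := @iter_embed p (whilep i c p) Some (Some None)
  _ u1 (pstart p) s1 s2 run1.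
  by move=> x h /=; case: (pdelta x h) => [[x'|] a].
exists (u2 + v1).+1; first by lia.
by rewrite iterSr /= ffunE cs iterD r1.
Qed.

(* One step pushes at most one bit. *)
Lemma size_runs p s s' t i :
  runs p s s' t -> size (get s' i) <= size (get s i) + t.
Proof.
case=> u le_u run; apply: leq_trans (leq_add (leqnn _) le_u).
elim: u (Some (pstart p)) s run {le_u} => [|u IH] q s; first by case=> _ ->; lia.
rewrite iterSr; case: q => [q|] /=; last by move/IH; lia.
case: (pdelta q (tops s)) => o a /IH /leq_trans-> //.
rewrite addnS -addSn leq_add2r.
case: a => [[j [b|]]|] //=; rewrite /get /upd nth_set_nth /=; case: eqP => [->|_];
  by rewrite /= ?size_behead /get; lia.
Qed.

End StackPrograms.

(** * Compilation to Turing machines *)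

(* The top of a register is the scanned cell, and everything to the left of   *)
(* the head is blank.  A push takes two steps: the pair [(i, b)] in a state   *)
(* is a bit still to be written.                                              *)
Section Compilation.
Variables (K : nat) (p : prog K).
Local Notation reg := 'I_K.+1.
Local Notation cell := (option (bool + void)).

Definition cell_bit (x : cell) : option bool :=
  if x is Some (inl b) then Some b else None.

Definition compiled_state : finType :=
  (option (pstate p) * option (reg * bool))%type.

Definition at_reg (i : reg) (a : cell * move) (h : {ffun reg -> cell}) :
    {ffun reg -> cell * move} :=
  [ffun j => if j == i then a else (h j, Stay)].

Definition compiled_delta (x : compiled_state) (h : {ffun reg -> cell}) :
    compiled_state * {ffun reg -> cell * move} :=
  if x.2 is Some (i, b) then ((x.1, None), at_reg i (Some (inl b), Stay) h) else
  if x.1 is Some q then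
    let: (o, a) := pdelta q [ffun i => cell_bit (h i)] in
    match a with
    | None => ((o, None), [ffun j => (h j, Stay)])
    | Some (i, None) => ((o, None), at_reg i (None, MoveRight) h)
    | Some (i, Some b) => ((o, Some (i, b)), at_reg i (h i, MoveLeft) h)
    end
  else (x, [ffun j => (h j, Stay)]).

Definition compiled : turing_machine :=
  @TuringMachine compiled_state void K (Some (pstart p), None)
    (fun x => ~~ isSome x.2 && ~~ isSome x.1) compiled_delta.

Definition cells (l : seq bool) : seq cell := [seq Some (inl b) | b <- l].

(** Cells are compared through [nth] with default blank, because lists that differ only by trailing
    blanks describe the same tape. *)
Definition holds (t : tape (bool + void)) (l : seq bool) : Prop :=
  (forall k, nth None (tape_head t :: tape_right t) k = nth None (cells l) k) /\
  (forall k, nth None (tape_left t) k = None).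

Lemma holds_head t l : holds t l -> cell_bit (tape_head t) = ohead l.
Proof. by case=> /(_ 0) /= -> _; case: l. Qed.

Lemma holds_stay t l :
  holds t l -> holds (tape_move Stay (tape_write (tape_head t) t)) l.
Proof. by case: t. Qed.

Lemma holds_pop t l :
  holds t l -> holds (tape_move MoveRight (tape_write None t)) (behead l).
Proof.
case: t => L x r [H1 /= H2]; split; last by case.
move=> k /=; have {H1}: nth None r k = nth None (cells (behead l)) k.
  by have := H1 k.+1 => /= ->; case: l {H1} => //=; case: k.
by move=> <-; case: r k => [|y r] [|k] //=; rewrite nth_nil.
Qed.

(** Moving left exposes a blank cell, which the second step overwrites with [b]. *)
Lemma holds_push t l b :
  holds t l ->
  holds (tape_move Stay (tape_write (Some (inl b))
          (tape_move MoveLeft (tape_write (tape_head t) t)))) (b :: l).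
Proof.
case: t => L x r [H1 /= H2]; split=> /=; first by case.
by move=> k; rewrite nth_behead.
Qed.

Definition represents (T : {ffun reg -> tape (bool + void)}) (s : store) : Prop :=
  forall i : reg, holds (T i) (get s i).

Lemma compiled_pstep q T s : represents T s ->
  exists u (T' : {ffun reg -> tape (bool + void)}),
    let c := @pstep K p (Some q, s) in
    [/\ u <= 2, represents T' c.2 &
        iter u (@tm_step compiled) ((Some q, None), T) = ((c.1, None), T')].
Proof.
move=> TS /=.
have tE : [ffun i => cell_bit ([ffun i => tape_head (T i)] i)] = tops K s.
  by apply/ffunP=> i; rewrite !ffunE (holds_head (TS i)).
have ordE (i j : reg) : (nat_of_ord i == j) = (i == j) by [].
case e: (pdelta q (tops K s)) => [o a].
case: a e => [[i [b|]]|] e /=.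
- eexists 2, _; split; [by [] | | by rewrite /= /compiled_delta /= tE e /=; reflexivity].
  move=> j; rewrite !ffunE /get /upd nth_set_nth /= ordE.
  case: (eqVneq j i) => [->|_] /=; first exact/holds_push/TS.
  exact/holds_stay/holds_stay/TS.
- eexists 1, _; split; [by [] | | by rewrite /= /compiled_delta /= tE e /=; reflexivity].
  move=> j; rewrite !ffunE /get /upd nth_set_nth /= ordE.
  by case: (eqVneq j i) => [->|_] /=; [apply/holds_pop/TS | apply/holds_stay/TS].
- eexists 1, _; split; [by [] | | by rewrite /= /compiled_delta /= tE e /=; reflexivity].
  by move=> j; rewrite !ffunE; apply/holds_stay/TS.
Qed.

Lemma compiled_iter t q T s s' : represents T s ->
  iter t (@pstep K p) (q, s) = (None, s') ->
  exists u (T' : {ffun reg -> tape (bool + void)}),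
    [/\ u <= 2 * t, represents T' s' &
        iter u (@tm_step compiled) ((q, None), T) = ((None, None), T')].
Proof.
elim: t q T s => [|t IH] q T s TS.
  by case=> -> <-; exists 0, T.
case: q => [q|]; last by rewrite iter_exit => -[<-]; exists 0, T.
have [u [T1 [le_u TS1 run1]]] := compiled_pstep q TS.
rewrite iterSr; case: (pstep _) TS1 run1 => o s1 /= TS1 run1 /(IH _ _ _ TS1).
case=> v [T2 [le_v TS2 run2]]; exists (v + u), T2; split=> //; first by lia.
by rewrite iterD run1.
Qed.

Lemma read_bits_holds s l :
  (forall k, nth None s k = nth None (cells l) k) -> @read_bits compiled s = l.
Proof.
elim: l s => [|b l IH] [|x s] H //=; first by have /= -> := H 0.
- by have := H 0.
- by have /= -> := H 0; rewrite IH // => k; have := H k.+1.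
Qed.

Lemma compiled_computes w s' t :
  runs p (w :: nseq K [::]) s' t ->
  @tm_computes_in compiled (2 * t) w (get s' (@ord_max K)).
Proof.
case=> u le_u run; have init : represents (@tm_init compiled w).2 (w :: nseq K [::]).
  move=> i; rewrite ffunE /get -(inj_eq val_inj) /=.
  case: (val i) => [|j]; rewrite /= ?nth_nseq ?if_same.
    by split=> [k|[]//]; case: w {run} => [|b w] //; case: k => [|[]].
  by split=> -[|[]].
have [v [T [le_v TS r]]] := compiled_iter init run.
rewrite /tm_computes_in.
(* The halted configuration is fixed by [tm_step], so the run can be padded to exactly [2 * t]
   steps. *)
have -> : iter (2 * t) (@tm_step compiled) (@tm_init compiled w) = ((None, None), T).
  rewrite -(subnK (_ : v <= 2 * t)); last by lia.
  by rewrite iterD r; elim: (_ - _) => //= k ->.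
by split=> //; apply: read_bits_holds; have [] := TS ord_max.
Qed.

End Compilation.

(** * Polynomial bounds *)

Definition poly_bounded (f : nat -> nat) : Prop :=
  exists a d, forall n, f n <= a * n ^ d + a.

(** The time may be measured in any parameter bounded by the input length, such as the number of
    vertices: the bounding polynomial is monotone even if [time] is not. *)
Lemma poly_time_runs (X : Type) (src dst : X -> seq bool) K (p : prog K)
    (time : nat -> nat) :
  poly_bounded time ->
  (forall x, exists2 n, n <= size (src x) & exists2 s',
     runs p (src x :: nseq K [::]) s' (time n) & get s' (@ord_max K) = dst x) ->
  poly_time src dst.
Proof.
move=> [a [d bound]] run; exists (compiled p), (2 * a), d => x.
have [n le_n [s' r <-]] := run x.
suff: runs p (src x :: nseq K [::]) s' (a * size (src x) ^ d + a).
  by move/compiled_computes; rewrite mulnDr mulnA.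
apply: runs_le r (leq_trans (bound n) _).
rewrite leq_add2r leq_mul2l; case: d {bound} => [|d]; first by rewrite orbT.
by rewrite leq_exp2r // le_n orbT.
Qed.

Lemma poly_bounded_const c : poly_bounded (fun=> c).
Proof. by exists c, 0 => n; lia. Qed.

Lemma poly_bounded_id : poly_bounded id.
Proof. by exists 1, 1 => n; lia. Qed.

(** The summand 1 covers n = d = 0, where the left side is 0^0 = 1. *)
Lemma expn_le_poly n d e : d <= e -> n ^ d <= n ^ e + 1.
Proof.
case: n => [|n] le_de.
  by case: d le_de => [|d] _; [rewrite expn0 leq_addl | rewrite exp0n].
by rewrite (leq_trans _ (leq_addr _ _)) // leq_pexp2l.
Qed.

Lemma poly_boundedD f g :
  poly_bounded f -> poly_bounded g -> poly_bounded (fun n => f n + g n).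
Proof.
move=> [a [d F]] [b [e G]]; exists (2 * (a + b)), (d + e) => n.
have := leq_mul (leqnn a) (expn_le_poly n (leq_addr e d)).
have := leq_mul (leqnn b) (expn_le_poly n (leq_addl d e)).
by have := F n; have := G n; rewrite !mulnDr !mulnDl; lia.
Qed.

Lemma poly_boundedM f g :
  poly_bounded f -> poly_bounded g -> poly_bounded (fun n => f n * g n).
Proof.
move=> [a [d F]] [b [e G]]; exists (4 * (a * b)), (d + e) => n.
have := leq_mul (leqnn (a * b)) (expn_le_poly n (leq_addr e d)).
have := leq_mul (leqnn (a * b)) (expn_le_poly n (leq_addl d e)).
have := leq_mul (F n) (G n); rewrite expnD.
by move: (n ^ d) (n ^ e) (f n * g n) => x y z; nia.
Qed.

(** * Keys and target sets *)

(** Blocks are added in front because the head of a word is the top of its stack; the recursion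
    follows the loops of [gen]. *)
Fixpoint words (n k : nat) (y : seq bool) : seq (seq bool) :=
  if k is k'.+1 then
    words n k' y ++ flatten [seq words n k' (nseq j false ++ true :: y) | j <- iota 0 n]
  else [:: y].

Lemma words_size n k (y z : seq bool) : z \in words n k y -> size y <= size z.
Proof.
elim: k y => [|k IH] y /=; first by rewrite inE => /eqP->.
rewrite mem_cat => /orP[/IH //|/flatten_mapP[j _ /IH]].
by rewrite size_cat /=; lia.
Qed.

Lemma mem_words_base n k y : y \in words n k y.
Proof. by elim: k y => [|k IH] y; rewrite /= ?inE // mem_cat IH. Qed.

(** Trailing zeros are split off; the default [true] of [last] lets the remaining part be empty. *)
Lemma last_trueP (p : seq bool) :
  exists q r, p = q ++ nseq r false /\ (last true q = true).
Proof.
elim/last_ind: p => [|p [] [q [r [-> lq]]]]; first by exists [::], 0.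
  by exists (rcons (q ++ nseq r false) true), 0; rewrite cats0 last_rcons.
exists q, r.+1; split=> //.
by rewrite -cats1 -catA -[[:: false]]/(nseq 1 false) -nseqD addn1.
Qed.

(** Induction on [k], splitting off the last block 0^r 1 of [p], which is the one that the outermost
    choice puts in front of [y]. *)
Lemma mem_words n k p y :
  last true p -> size p <= n -> count id p <= k -> p ++ y \in words n k y.
Proof.
elim: k p y => [|k IH] p y; case/lastP: p => [|p b] lp sp cp;
  try exact: mem_words_base.
  by move: lp cp; rewrite last_rcons => ->; rewrite -cats1 count_cat /=; lia.
move: lp; rewrite last_rcons; case: b sp cp => // sp cp _.
have [q [r [pE lq]]] := last_trueP p; subst p.
move: sp cp; rewrite size_rcons -cats1 !count_cat /= size_cat size_nseq => sp cp.
rewrite mem_cat; apply/orP; right; apply/flatten_mapP; exists r.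
  by rewrite mem_iota; lia.
by rewrite -!catA; apply: IH; rewrite ?lq //; lia.
Qed.

Definition mask_inter (z row : seq bool) : seq bool :=
  [seq p.1 && p.2 | p <- zip z row].

(** The trailing zeros of [w] are supplied by the padding 0^n, cut off at length [n]. *)
Lemma words_complete n k w :
  size w = n -> count id w <= k ->
  exists2 z, z \in words n k (nseq n false) & take n z = w.
Proof.
move=> sw cw; have [q [r [wE lq]]] := last_trueP w.
have sq : size q + r = n by rewrite -sw wE size_cat size_nseq.
exists (q ++ nseq n false).
  apply: mem_words; rewrite ?lq //; first by lia.
  by move: cw; rewrite wE count_cat; lia.
rewrite wE take_cat ltnNge -{1}sq leq_addr /=; congr (_ ++ _).
by rewrite take_nseq; [congr nseq|]; lia.
Qed.

(** * Forward chaining is activation *)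

Section Horn.
Variables (c : nat) (I : tss_instance).
Local Notation n := (tss_order I).

Definition masked_neighbors (z : seq bool) (v : 'I_n) : {set 'I_n} :=
  [set i in tss_neighbors v | nth false z i].

Definition horn_of_tss : horn_cnf :=
  HornCnf (flatten
    [seq [seq (masked_neighbors z v, v) |
           z <- words n c (nseq n false) & tss_threshold v <= #|masked_neighbors z v|]
    | v <- enum 'I_n]).

Lemma horn_clauseP (A : {set 'I_n}) v :
  reflect (exists z, [/\ z \in words n c (nseq n false), A = masked_neighbors z v
                     & tss_threshold v <= #|A|])
          ((A, v) \in horn_clauses horn_of_tss).
Proof.
apply: (iffP flatten_mapP) => [[u _ /mapP[z]]|[z [zw AE tA]]].
  by rewrite mem_filter => /andP[tz zw] [-> ->]; exists z.
exists v; first by rewrite mem_enum.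
by apply/mapP; exists z; rewrite ?mem_filter -?AE ?tA.
Qed.

Lemma masked_neighbors_subset z v : masked_neighbors z v \subset tss_neighbors v.
Proof. by apply/subsetP=> i; rewrite inE => /andP[]. Qed.

Lemma count_set_code m (A : {set 'I_m}) : count id (set_code A) = #|A|.
Proof.
rewrite count_map enumT cardE /enum_mem size_filter.
by apply: eq_count.
Qed.

Lemma horn_clause_neighbors (v : 'I_n) (A : {set 'I_n}) :
  A \subset tss_neighbors v -> tss_threshold v <= #|A| -> #|A| <= c ->
  (A, v) \in horn_clauses horn_of_tss.
Proof.
move=> AN tA Ac.
have sA : size (set_code A) = n by rewrite size_map size_enum_ord.
have [|z zw zA] := @words_complete n c (set_code A) sA; first by rewrite count_set_code.
apply/horn_clauseP; exists z; split=> //; apply/setP=> i; rewrite inE.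
have -> : nth false z i = (i \in A).
  by rewrite -(nth_take _ (ltn_ord i)) zA (nth_map i) ?size_enum_ord // nth_ord_enum.
by case Ai: (i \in A); rewrite ?andbF // (subsetP AN _ Ai).
Qed.

Lemma subset_activate (A : {set 'I_n}) : A \subset activate A.
Proof. exact: subsetUl. Qed.

Lemma subset_iter_activate k (A : {set 'I_n}) : A \subset iter k (@activate I) A.
Proof. by elim: k => //= k IH; apply: subset_trans IH (subset_activate _). Qed.

(** Otherwise each of n+1 rounds would add a vertex. *)
Lemma activate_closure (S : {set 'I_n}) :
  exists k, activate (iter k (@activate I) S) = iter k (@activate I) S.
Proof.
have [/existsP[k /eqP]|] := boolP [exists k : 'I_n.+1,
    @activate I (iter k (@activate I) S) == iter k (@activate I) S]; first by exists k.
rewrite negb_exists => /forallP grow.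
suff grows : forall k, k <= n.+1 -> k <= #|iter k (@activate I) S|.
  have := leq_trans (grows n.+1 (leqnn _)) (max_card _).
  by rewrite card_ord ltnn.
elim=> // k IH lt_k; apply: leq_ltn_trans (IH (ltnW lt_k)) _.
apply: proper_card; rewrite properEneq subset_activate andbT.
by rewrite eq_sym; apply: (grow (Ordinal lt_k)).
Qed.

Hypothesis bounded : thresholds_at_most c I.

Lemma key_target_set (S : {set 'I_n}) :
  @key horn_of_tss S <-> target_set S.
Proof.
split=> [keyS|[k kS] u uS x xPhi].
  have [k closed] := activate_closure S; exists k.
  set C := iter k _ S in closed *.
  have SC : S \subset C by apply: subset_iter_activate.
  apply/setP=> u; rewrite inE; have [/(subsetP SC)//|uS] := boolP (u \in S).
  (* The indicator of the closure [C] is a model: a clause with body inside [C] has its head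
     activated in the next round, which adds nothing new. The key property then forces [u] into
     [C]. *)
  have: @satisfies horn_of_tss (fun i => i \in C).
    apply/allP=> -[A v] /horn_clauseP[z [_ AE tA]]; rewrite /satisfies_clause /=.
    have [AC|/subsetPn[i iA iC]] := boolP (A \subset C); last first.
      by apply/orP; right; apply/existsP; exists i; rewrite iA.
    rewrite -closed !inE (leq_trans tA) ?orbT // subset_leq_card // subsetI AC.
    by rewrite AE masked_neighbors_subset.
  move/(keyS u uS); rewrite /satisfies_clause /= => /orP[//|/existsP[i /andP[iS]]].
  by rewrite (subsetP SC).
rewrite /satisfies_clause /=; have [_|/existsPn Sx] := boolP [exists a in S, ~~ x a].
  by rewrite orbT.
rewrite orbF; suff: forall v, v \in iter k (@activate I) S -> x v.
  by apply; rewrite kS inE.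
elim: k {kS} => [|k IH] v /=.
  by move=> vS; have := Sx v; rewrite vS /= negbK.
(* Only t(v) active neighbors are kept, so that the body [B] has at most [c] elements and the clause
   is in the formula. *)
rewrite !inE => /orP[/IH //|/card_geqP[s [us ss sA]]].
pose B := [set i in s].
have BA i : i \in B -> (i \in tss_neighbors v) && (i \in iter k (@activate I) S).
  by rewrite inE => /sA; rewrite inE.
have cB : #|B| = tss_threshold v by rewrite cardsE (card_uniqP us).
have /(allP xPhi) : (B, v) \in horn_clauses horn_of_tss.
  apply: horn_clause_neighbors; rewrite ?cB //.
  by apply/subsetP=> i /BA/andP[].
rewrite /satisfies_clause /= => /orP[//|/existsP[i /andP[iB]]].
by have /andP[_ /IH ->] := BA i iB.
Qed.

End Horn.

(** * The program computing the formula *)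

(* [ROW'], [WORD'] and [THR'] hold what a pass over [ROW], [WORD] and [THR]   *)
(* has consumed, in reverse order; [ACC] holds the output in reverse order.   *)
Local Notation IN := (@Ordinal 13 0 isT).
Local Notation N := (@Ordinal 13 1 isT).
Local Notation CNT := (@Ordinal 13 2 isT).
Local Notation TMP := (@Ordinal 13 3 isT).
Local Notation ROW := (@Ordinal 13 4 isT).
Local Notation THR := (@Ordinal 13 5 isT).
Local Notation IDX := (@Ordinal 13 6 isT).
Local Notation WORD := (@Ordinal 13 7 isT).
Local Notation WORD' := (@Ordinal 13 8 isT).
Local Notation ROW' := (@Ordinal 13 9 isT).
Local Notation THR' := (@Ordinal 13 10 isT).
Local Notation ACC := (@Ordinal 13 11 isT).
Local Notation OUT := (@Ordinal 13 12 isT).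

Local Notation reg := 'I_13.
Local Notation prg := (prog 12).

(** * Elementary register programs *)

Definition push (i : reg) (b : bool) : prg := do (Some (i, Some b)).
Definition pop (i : reg) : prg := do (Some (i, None)).
Definition skip : prg := do None.

Definition top_true (o : option bool) : bool := if o is Some b then b else false.

Definition shift (i j : reg) : prg :=
  ifp i top_true (seqp (pop i) (push j true)) (seqp (pop i) (push j false)).

(** The bits arrive in reverse order, so a pass followed by the way back restores a register. *)
Definition movep (i j : reg) : prg := whilep i isSome (shift i j).

Definition clear (i : reg) : prg := whilep i isSome (pop i).

Definition read_num (j : reg) : prg :=
  seqp (whilep IN top_true (seqp (pop IN) (push j true))) (pop IN).

Definition copy (i j : reg) : prg :=
  seqp (whilep i isSome (seqp (pop i) (seqp (push TMP true) (push j true))))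
       (movep TMP i).

(** The bit [false] marks the bottom of this loop's counter and protects the counters of the
    enclosing loops below it. *)
Definition rep (body : prg) : prg :=
  seqp (push CNT false) (seqp (copy N CNT)
    (seqp (whilep CNT top_true (seqp (pop CNT) body)) (pop CNT))).

Lemma store_eq (s s' : store) :
  size s = size s' -> (forall k, nth [::] s k = nth [::] s' k) -> s = s'.
Proof. by move=> eq_sz eq_s; apply: (eq_from_nth eq_sz) => k _; apply: eq_s. Qed.

Lemma runs_eq K (p : prog K) s s1 s2 t : runs p s s1 t -> s1 = s2 -> runs p s s2 t.
Proof. by move=> r <-. Qed.

Lemma runs_push i b s : runs (push i b) s (upd s i (b :: get s i)) 1.
Proof. exact: runs_do. Qed.

Lemma runs_pop i s : runs (pop i) s (upd s i (behead (get s i))) 1.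
Proof. exact: runs_do. Qed.

Lemma runs_shift (i j : reg) s b l : get s i = b :: l ->
  runs (shift i j) s (upd (upd s i l) j (b :: get (upd s i l) j)) 3.
Proof.
move=> si; apply: runs_if; rewrite si /=.
by case: b si => si; apply: (runs_seq (t1 := 1) (t2 := 1));
  first [apply: runs_push | apply: (runs_eq (runs_pop _ _)); rewrite si].
Qed.

Lemma get_upd (s : store) (i j : reg) l :
  get (upd s i l) j = if j == i then l else get s j.
Proof. by rewrite /get /upd nth_set_nth. Qed.

Lemma size_upd (s : store) (i : reg) l : size (upd s i l) = maxn i.+1 (size s).
Proof. exact: size_set_nth. Qed.

Lemma nth_upd (s : store) (i : reg) l k :
  nth [::] (upd s i l) k = if k == i then l else nth [::] s k.
Proof. by rewrite nth_set_nth. Qed.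

Ltac store_ext := apply: store_eq => [|?];
  [rewrite !size_upd; simpl in *; lia
  | repeat match goal with H : is_true (_ != _) |- _ =>
      rewrite -val_eqE /= in H; move: H end;
    rewrite !nth_upd /= => *;
    repeat (case: eqP => ? //); subst => //; first [congruence | lia]].

Lemma runs_move (i j : reg) s l : get s i = l -> i != j -> maxn i j < size s ->
  runs (movep i j) s (upd (upd s i [::]) j (catrev l (get s j))) (4 * size l + 1).
Proof.
elim: l s => [|b l IH] s si ne sz.
  apply: runs_eq; first by apply: runs_while_exit; rewrite si.
  rewrite -[X in upd s i X]si; store_ext.
apply: (runs_le (t := (3 + (4 * size l + 1)).+1)); last by rewrite /=; lia.
apply: runs_eq.
  apply: runs_while_loop; [by rewrite si | exact: runs_shift si |].
  apply: IH; rewrite ?get_upd ?eqxx ?(negbTE ne) //.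
  by rewrite !size_upd; lia.
rewrite !get_upd eqxx eq_sym (negbTE ne) /=; store_ext.
Qed.

Lemma nseq_cat_cons m (l : seq bool) : nseq m true ++ true :: l = nseq m.+1 true ++ l.
Proof. by elim: m => //= m ->. Qed.

Lemma runs_copy (i j : reg) s m : get s i = nseq m true -> get s TMP = [::] ->
  i != j -> i != TMP -> j != TMP -> maxn TMP (maxn i j) < size s ->
  runs (copy i j) s (upd s j (nseq m true ++ get s j)) (8 * m + 2).
Proof.
move=> si sT ij iT jT sz.
apply: (runs_le (t := (4 * m + 1) + (4 * m + 1))); last by lia.
pose mid (s : store) := upd (upd (upd s i [::]) TMP (nseq m true ++ get s TMP))
  j (nseq m true ++ get s j).
apply: (runs_seq (s2 := mid s)).
  rewrite {}/mid {sT}; elim: m s si sz => [|m IH] s si sz.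
    apply: runs_eq; first by apply: runs_while_exit; rewrite si.
    rewrite -[X in upd s i X]si; store_ext.
  apply: (runs_le (t := (3 + (4 * m + 1)).+1)); last by lia.
  apply: runs_eq.
    apply: runs_while_loop; [by rewrite si | |].
      apply: (runs_seq (t1 := 1) (t2 := 2)); first exact: runs_pop.
      by apply: (runs_seq (t1 := 1) (t2 := 1)); exact: runs_push.
    by apply: IH; rewrite ?size_upd ?get_upd ?si /= ?eqxx ?(negbTE ij) ?(negbTE iT) //; lia.
  rewrite !get_upd ?eqxx ?(negbTE jT) !(eq_sym _ i) ?(negbTE ij) ?(negbTE iT).
  rewrite !(eq_sym _ j) (negbTE jT) !nseq_cat_cons; store_ext.
apply: runs_eq.
  apply: (runs_le (runs_move (i := TMP) (j := i) (l := nseq m true) _ _ _)).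
  - by rewrite !get_upd eqxx eq_sym (negbTE jT) sT cats0.
  - by rewrite eq_sym.
  - by rewrite !size_upd; lia.
  - by rewrite size_nseq.
rewrite /mid !get_upd (negbTE ij) (negbTE iT) eqxx catrevE rev_nseq cats0 -si.
store_ext.
Qed.

Lemma runs_clear (i : reg) s l : get s i = l -> i < size s ->
  runs (clear i) s (upd s i [::]) (2 * size l + 1).
Proof.
elim: l s => [|b l IH] s si sz.
  apply: runs_eq; first by apply: runs_while_exit; rewrite si.
  rewrite -[X in upd s i X]si; store_ext.
apply: (runs_le (t := (1 + (2 * size l + 1)).+1)); last by rewrite /=; lia.
apply: runs_eq.
  apply: runs_while_loop; [by rewrite si | exact: runs_pop |].
  by apply: IH; rewrite ?get_upd ?eqxx ?si // size_upd; lia.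
store_ext.
Qed.

Lemma runs_read_num (j : reg) s m l : get s IN = nat_code m ++ l ->
  IN != j -> j < size s ->
  runs (read_num j) s (upd (upd s IN l) j (nseq m true ++ get s j)) (3 * m + 2).
Proof.
move=> si ij sz.
apply: (runs_le (t := (3 * m + 1) + 1)); last by lia.
apply: (runs_seq (s2 := upd (upd s IN (false :: l)) j (nseq m true ++ get s j))).
  elim: m s si sz => [|m IH] s si sz.
    apply: runs_eq; first by apply: runs_while_exit; rewrite si.
    rewrite -[false :: l]si; store_ext.
  apply: (runs_le (t := (2 + (3 * m + 1)).+1)); last by lia.
  apply: runs_eq.
    apply: runs_while_loop; [by rewrite si | |].
      by apply: (runs_seq (t1 := 1) (t2 := 1)); [exact: runs_pop | exact: runs_push].
    by apply: IH; rewrite ?size_upd ?get_upd ?si /= ?(negbTE ij) //; lia.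
  rewrite !get_upd ?eqxx !(eq_sym j) (negbTE ij) nseq_cat_cons; store_ext.
apply: runs_eq; first exact: runs_pop.
rewrite !get_upd (negbTE ij) /=; store_ext.
Qed.

(* The loop counter is pushed on top of [CNT], so that loops can be nested. *)
Lemma runs_rep n t (i_ : nat -> seq bool) (r_ : nat -> store) cnt body :
  (forall k cnt', k < n ->
     runs body (i_ k :: nseq n true :: cnt' :: [::] :: r_ k)
               (i_ k.+1 :: nseq n true :: cnt' :: [::] :: r_ k.+1) t) ->
  runs (rep body) (i_ 0 :: nseq n true :: cnt :: [::] :: r_ 0)
    (i_ n :: nseq n true :: cnt :: [::] :: r_ n) (n * (t + 10) + 5).
Proof.
move=> run.
apply: (runs_le (t := 1 + ((8 * n + 2) + ((n * (t + 2) + 1) + 1)))); last by lia.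
apply: runs_seq; first exact: runs_push.
apply: runs_seq; first by apply: (runs_copy (m := n)).
apply: (runs_seq (s2 := i_ n :: nseq n true :: (false :: cnt) :: [::] :: r_ n));
  last exact: runs_pop.
rewrite /upd /get /=.
have loop m : m <= n ->
    runs (whilep CNT top_true (seqp (pop CNT) body))
      (i_ (n - m) :: nseq n true :: (nseq m true ++ false :: cnt) :: [::] :: r_ (n - m))
      (i_ n :: nseq n true :: (false :: cnt) :: [::] :: r_ n) (m * (t + 2) + 1).
  elim: m => [|m IH] le_m; first by rewrite subn0; apply: runs_while_exit.
  apply: (runs_le (t := ((1 + t) + (m * (t + 2) + 1)).+1)); last by lia.
  apply: runs_while_loop (IH (ltnW le_m)); first by [].
  apply: runs_seq; first exact: runs_pop.
  by rewrite (_ : n - m = (n - m.+1).+1); [apply: run; lia | lia].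
by have := loop n (leqnn n); rewrite subnn.
Qed.

(** * Emitting the clauses of one vertex *)

Definition read_row : prg := seqp (rep (shift IN ROW')) (movep ROW' ROW).

Lemma runs_read_row n row rest cnt rest' t v y x t2 acc out :
  size row = n -> rest = row ++ rest' ->
  runs read_row
    [:: rest; nseq n true; cnt; [::]; [::]; t; v; y; x; [::]; t2; acc; out]
    [:: rest'; nseq n true; cnt; [::]; row; t; v; y; x; [::]; t2; acc; out]
    (17 * n + 6).
Proof.
move=> sz ->; apply: (runs_le (t := (n * (3 + 10) + 5) + (4 * n + 1))); last by lia.
apply: runs_seq.
  pose i_ k := drop k row ++ rest'.
  pose r_ k := [:: [::]; t; v; y; x; rev (take k row); t2; acc; out].
  have -> : row ++ rest' = i_ 0 by rewrite /i_ drop0.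
  have -> : [:: [::]; t; v; y; x; [::]; t2; acc; out] = r_ 0 by rewrite /r_ take0.
  apply: runs_rep => k cnt' lt_k; rewrite /i_ /r_.
  rewrite (drop_nth false) ?sz // (take_nth false) ?sz // rev_rcons.
  exact: runs_shift.
rewrite /= drop_oversize ?take_oversize ?sz //=.
apply: runs_eq; first by apply: (runs_le (runs_move _ _ _)); rewrite // size_rev sz.
by rewrite /upd /get /= catrevE revK cats0.
Qed.

(** Each common 1 of mask and row removes one unit from [THR], so after a full pass [THR] is empty
    exactly when the threshold is met. *)
Definition test_bit : prg :=
  seqp
    (ifp WORD top_true
      (ifp ROW top_true
        (seqp (push ACC true)
          (ifp THR isSome (seqp (pop THR) (push THR' true)) skip))
        (push ACC false))
      (push ACC false))
    (seqp (shift WORD WORD') (shift ROW ROW')).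

Lemma runs_test_bit i n cnt tmp a b row t v y x r t2 acc out :
  runs test_bit
    [:: i; n; cnt; tmp; b :: row; nseq t true; v; a :: y; x; r; t2; acc; out]
    [:: i; n; cnt; tmp; row; nseq (t - (a && b)) true; v; y; a :: x; b :: r;
        nseq (minn t (a && b)) true ++ t2; (a && b) :: acc; out] 12.
Proof.
apply: (runs_le (t := 6 + (3 + 3))) => //.
apply: (runs_seq (s2 := [:: i; n; cnt; tmp; b :: row; nseq (t - (a && b)) true; v;
    a :: y; x; r; nseq (minn t (a && b)) true ++ t2; (a && b) :: acc; out])); last first.
  by apply: runs_seq; apply: runs_shift.
case: a; last first.
  apply: (runs_le (t := 2)) => //; apply: runs_if; apply: runs_eq; first exact: runs_push.
  by rewrite subn0 minn0.
apply: (runs_le (t := 6)) => //; apply: runs_if; rewrite /get /=; case: b; last first.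
  apply: (runs_le (t := 2)) => //; apply: runs_if; apply: runs_eq; first exact: runs_push.
  by rewrite subn0 minn0.
apply: runs_if; rewrite /get /=.
apply: (runs_seq (t1 := 1) (t2 := 3)); first exact: runs_push.
apply: runs_if; rewrite /get /=.
case: t => [|t] /=; first by apply: (runs_le (t := 1)) => //; apply: runs_do.
apply: (runs_seq (t1 := 1) (t2 := 1)); first exact: runs_pop.
by apply: runs_eq; [exact: runs_push | rewrite subn1].
Qed.

(** The clause is written before it is known to be admissible. If the threshold is missed, the [n]
    bits of the body and the leading [true] are popped again; otherwise the head of the clause is
    appended. *)
Definition check : prg :=
  seqp (push ACC true) (seqp (rep test_bit)
    (seqp (movep WORD' WORD) (seqp (movep ROW' ROW)
      (seqp (ifp THR isSome
              (seqp (rep (pop ACC)) (pop ACC))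
              (seqp (copy IDX ACC) (push ACC false)))
            (movep THR' THR))))).

Definition clause_word (row : seq bool) (t v : nat) (z : seq bool) : seq bool :=
  let A := mask_inter z row in
  if t <= count id A then true :: A ++ nat_code v else [::].

Lemma size_mask_inter z row : size row <= size z -> size (mask_inter z row) = size row.
Proof. by move=> le_sz; rewrite size_map size2_zip. Qed.

(** The condition [3 < j] keeps the popped register apart from the four that [runs_rep] displays
    explicitly. *)
Lemma runs_rep_pop (j : reg) n i cnt (s : store) l l' :
  let S := i :: nseq n true :: cnt :: [::] :: s in
  3 < j < size S -> size l = n -> get S j = l ++ l' ->
  runs (rep (pop j)) S (upd S j l') (11 * n + 5).
Proof.
case: j => [[|[|[|[|j]]]] lt_j] //; rewrite /get /upd /= => sz sz_l sj.
apply: (runs_le (t := n * (1 + 10) + 5)); last by lia.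
pose r_ k := set_nth [::] s j (drop k l ++ l').
have -> : set_nth [::] s j l' = r_ n by rewrite /r_ drop_oversize ?sz_l.
have {1}-> : s = r_ 0.
  rewrite /r_ drop0 -sj; apply: store_eq; first by rewrite size_set_nth; lia.
  by move=> k; rewrite nth_set_nth /=; case: eqP => [->|].
apply: (@runs_rep n 1 (fun=> i) r_ cnt (pop _)) => k cnt' lt_k.
apply: runs_eq; first exact: runs_pop.
rewrite /r_ /upd /get /= nth_set_nth /= eqxx set_set_nth eqxx.
by rewrite (drop_nth false) ?sz_l.
Qed.

Lemma runs_check n i cnt row t v y acc out : size row = n -> n <= size y ->
  runs check
    [:: i; nseq n true; cnt; [::]; row; nseq t true; nseq v true; y;
        [::]; [::]; [::]; acc; out]
    [:: i; nseq n true; cnt; [::]; row; nseq t true; nseq v true; y;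
        [::]; [::]; [::]; rev (clause_word row t v y) ++ acc; out]
    (41 * n + 8 * v + 4 * t + 40).
Proof.
move=> sz le_n; pose A := mask_inter y row.
have sA : size A = n by rewrite size_mask_inter ?sz.
pose m k := count id (take k A).
apply: (runs_le (t := 1 + ((n * (12 + 10) + 5) + ((4 * n + 1) + ((4 * n + 1) +
  ((11 * n + 8 * v + 10) + (4 * t + 1))))))); last by lia.
apply: runs_seq; first exact: runs_push.
rewrite /upd /get /=.
(* State after [k] positions, [m k] of which hold a common 1. The subtraction is truncated, and
   [THR] and [THR'] together always hold [t] units, so the last move restores the threshold. *)
pose r_ k := [:: drop k row; nseq (t - m k) true; nseq v true; drop k y;
  rev (take k y); rev (take k row); nseq (minn t (m k)) true;
  rev (take k A) ++ true :: acc; out].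
apply: (runs_seq (s2 := i :: nseq n true :: cnt :: [::] :: r_ n)).
  have -> : [:: row; nseq t true; nseq v true; y; [::]; [::]; [::]; true :: acc; out] = r_ 0.
    by rewrite /r_ /m !take0 !drop0 subn0 minn0.
  apply: (@runs_rep n 12 (fun=> i) r_ cnt test_bit) => k cnt' lt_k.
  have eA : nth false A k = nth false y k && nth false row k.
    by rewrite (nth_map (false, false)) ?nth_zip_cond ?size2_zip ?sz ?lt_k.
  apply: runs_eq.
    rewrite /r_ (drop_nth false (s := row)) ?sz // (drop_nth false (s := y)); last by lia.
    exact: runs_test_bit.
  rewrite /r_ /m !(take_nth false) ?sz ?sA //; last by lia.
  rewrite !rev_rcons -!cats1 !count_cat /= addn0 eA -nseqD subnDA.
  move: (count _ _) (_ && _) => u b.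
  by rewrite (_ : minn (t - u) b + minn t u = minn t (u + b)); last by lia.
apply: runs_seq.
  by apply: (runs_le (runs_move _ _ _)); rewrite // size_rev size_takel.
apply: runs_seq.
  by apply: (runs_le (runs_move _ _ _)); rewrite // size_rev size_takel ?sz.
rewrite /upd /get /= !catrevE !revK !cat_take_drop.
rewrite take_oversize ?sA // /m take_oversize ?sA //.
apply: (runs_seq (s2 := [:: i; nseq n true; cnt; [::]; row; nseq (t - count id A) true;
   nseq v true; y; [::]; [::]; nseq (minn t (count id A)) true;
   rev (clause_word row t v y) ++ acc; out])).
  rewrite /clause_word -/A; apply: (runs_le (t := (11 * n + 8 * v + 9).+1)); last by lia.
  apply: runs_if; rewrite /get /=; case: leqP => [le_t|lt_t].
    have -> : t - count id A = 0 by lia.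
    apply: (runs_le (t := (8 * v + 2) + 1)); last by lia.
    apply: runs_seq; first by apply: (runs_copy (m := v)).
    apply: runs_eq; first exact: runs_push.
    rewrite /upd /get /= /nat_code rev_cons rev_cat rev_rcons rev_nseq.
    by rewrite -cats1 /= -!catA.
  have -> : isSome (ohead (nseq (t - count id A) true)).
    by rewrite -(subnSK lt_t).
  apply: (runs_le (t := (11 * n + 5) + 1)); last by lia.
  apply: runs_seq; first by apply: (runs_rep_pop (l := rev A)); rewrite ?size_rev.
  exact: runs_pop.
apply: runs_eq.
  by apply: (runs_le (runs_move _ _ _)); rewrite // size_nseq; lia.
rewrite /upd /get /= catrevE rev_nseq -nseqD.
by congr [:: _; _; _; _; _; nseq _ _; _; _; _; _; _; _; _]; lia.
Qed.

Lemma flatten_map_flatten (A B C : Type) (f : B -> seq C) (g : A -> seq B) s :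
  flatten (map f (flatten (map g s))) = flatten [seq flatten (map f (g x)) | x <- s].
Proof. by elim: s => //= x s IH; rewrite map_cat flatten_cat IH. Qed.

(** After the word [y] itself, a 1 is pushed, and then 0s one at a time with a recursive call before
    each; the final pops restore [WORD]. *)
Fixpoint gen (k : nat) : prg :=
  if k is k'.+1 then
    seqp (gen k') (seqp (push WORD true)
      (seqp (rep (seqp (gen k') (push WORD false)))
        (seqp (rep (pop WORD)) (pop WORD))))
  else check.

(** Each level multiplies the time by n+1, hence a polynomial in [n] for each fixed depth [k]. *)
Fixpoint gen_time (k n t : nat) : nat :=
  if k is k'.+1 then (n + 1) * gen_time k' n t + (22 * n + 12)
  else 49 * n + 4 * t + 40.

Lemma runs_gen k n i cnt row t u v y acc out :
  size row = n -> n <= size y -> v <= n -> t <= u ->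
  runs (gen k)
    [:: i; nseq n true; cnt; [::]; row; nseq t true; nseq v true; y;
        [::]; [::]; [::]; acc; out]
    [:: i; nseq n true; cnt; [::]; row; nseq t true; nseq v true; y;
        [::]; [::]; [::];
        rev (flatten [seq clause_word row t v z | z <- words n k y]) ++ acc; out]
    (gen_time k n u).
Proof.
move=> sz + le_v le_t; elim: k i cnt y acc => [|k IH] i cnt y acc le_n.
  by rewrite /= cats0; apply: runs_le (runs_check _ _ _ _ _ _ sz le_n) _; lia.
pose E y' := flatten [seq clause_word row t v z | z <- words n k y'].
pose y_ j := nseq j false ++ true :: y.
pose acc_ j := rev (flatten [seq E (y_ j') | j' <- iota 0 j]) ++ rev (E y) ++ acc.
have -> : rev (flatten [seq clause_word row t v z | z <- words n k.+1 y]) ++ acc = acc_ n.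
  rewrite /acc_ /= map_cat flatten_cat rev_cat -catA; congr (rev _ ++ _).
  by rewrite flatten_map_flatten.
set T := gen_time k n u.
apply: (runs_le (t := T + (1 + ((n * ((T + 1) + 10) + 5) + ((11 * n + 5) + 1)))));
  last by rewrite /= -/T; lia.
apply: runs_seq; first exact: IH.
apply: runs_seq; first exact: runs_push.
rewrite /upd /get /= -/(E y).
pose r_ j := [:: row; nseq t true; nseq v true; y_ j; [::]; [::]; [::]; acc_ j; out].
apply: (runs_seq (s2 := i :: nseq n true :: cnt :: [::] :: r_ n)).
  apply: (@runs_rep n (T + 1) (fun=> i) r_ cnt) => j cnt' lt_j.
  apply: runs_seq; first by apply: IH; rewrite size_cat size_nseq /=; lia.
  apply: runs_eq; first exact: runs_push.
  rewrite /upd /get /=; rewrite /r_ /acc_ -(addn1 j) iotaD map_cat flatten_cat rev_cat.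
  by rewrite /= cats0 addn1 -!catA.
apply: runs_seq.
  by apply: (runs_rep_pop (l := nseq n false) (l' := true :: y)); rewrite ?size_nseq.
exact: runs_pop.
Qed.

Definition vertex (c : nat) : prg :=
  seqp read_row (seqp (read_num THR) (seqp (gen c)
    (seqp (clear ROW) (seqp (clear THR) (push IDX true))))).

Definition vertex_time (c n : nat) : nat := gen_time c n c + 5 * c + 19 * n + 20.

Lemma runs_vertex c n row t v rest rest' cnt y acc out :
  size row = n -> n <= size y -> v <= n -> t <= c ->
  rest = row ++ nat_code t ++ rest' ->
  runs (vertex c)
    [:: rest; nseq n true; cnt; [::]; [::]; [::]; nseq v true; y;
        [::]; [::]; [::]; acc; out]
    [:: rest'; nseq n true; cnt; [::]; [::]; [::]; nseq v.+1 true; y;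
        [::]; [::]; [::];
        rev (flatten [seq clause_word row t v z | z <- words n c y]) ++ acc; out]
    (vertex_time c n).
Proof.
move=> sz le_n le_v le_t ->.
apply: (runs_le (t := (17 * n + 6) + ((3 * t + 2) + (gen_time c n c +
  ((2 * n + 1) + ((2 * t + 1) + 1)))))); last by rewrite /vertex_time; lia.
apply: runs_seq; first by apply: runs_read_row sz _.
apply: runs_seq; first by apply: runs_read_num.
rewrite /upd /get /= cats0.
apply: runs_seq; first exact: runs_gen.
apply: runs_seq; first by apply: (runs_le (runs_clear (l := row) _ _)); rewrite ?sz.
apply: runs_seq; first by
  apply: (runs_le (runs_clear (l := nseq t true) _ _)); rewrite ?size_nseq.
exact: runs_push.
Qed.

(** * The complete reduction program *)

Definition reduce_acc (c : nat) : prg :=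
  seqp (read_num N) (seqp (copy N ACC) (seqp (push ACC false)
    (seqp (rep (push WORD false)) (seqp (rep (vertex c)) (push ACC false))))).

Definition reduce (c : nat) : prg := seqp (reduce_acc c) (movep ACC OUT).

Definition reduce_acc_time (c n : nat) : nat :=
  n * (vertex_time c n + 40) + 50.

Section Reduce.
Variables (c : nat) (I : tss_instance).
Hypothesis bounded : thresholds_at_most c I.
Local Notation n := (tss_order I).

Let row (v : 'I_n) := set_code (tss_neighbors v).
Let block (v : 'I_n) :=
  flatten [seq clause_word (row v) (tss_threshold v) v z | z <- words n c (nseq n false)].

Lemma size_set_code m (A : {set 'I_m}) : size (set_code A) = m.
Proof. by rewrite size_map size_enum_ord. Qed.

Lemma runs_reduce_acc :
  exists y v, runs (reduce_acc c) (tss_code I :: nseq 12 [::])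
    [:: [::]; nseq n true; [::]; [::]; [::]; [::]; v; y; [::]; [::]; [::];
        rev (nat_code n ++ flatten [seq block v | v <- enum 'I_n] ++ [:: false]); [::]]
    (reduce_acc_time c n).
Proof.
exists (nseq n false), (nseq n true).
apply: (runs_le (t := (3 * n + 2) + ((8 * n + 2) + (1 + ((n * (1 + 10) + 5) +
  ((n * (vertex_time c n + 10) + 5) + 1)))))); last by rewrite /reduce_acc_time; lia.
apply: runs_seq; first by apply: runs_read_num.
apply: runs_seq; first by apply: (runs_copy (m := n)); rewrite /upd /get /= ?cats0.
apply: runs_seq; first exact: runs_push.
rewrite /upd /get /= !cats0.
set code := flatten _.
pose s_ k := [:: [::]; [::]; [::]; nseq k false; [::]; [::]; [::];
  false :: nseq n true; [::]].
apply: (runs_seq (s2 := code :: nseq n true :: [::] :: [::] :: s_ n)).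
  by apply: (@runs_rep n 1 (fun=> code) s_) => k cnt' _; exact: runs_push.
pose i_ k := flatten [seq row v ++ nat_code (tss_threshold v) | v <- drop k (enum 'I_n)].
pose r_ k := [:: [::]; [::]; nseq k true; nseq n false; [::]; [::]; [::];
  rev (flatten [seq block v | v <- take k (enum 'I_n)]) ++ false :: nseq n true; [::]].
apply: (runs_seq (s2 := i_ n :: nseq n true :: [::] :: [::] :: r_ n)).
  have -> : code = i_ 0 by rewrite /i_ drop0.
  have -> : s_ n = r_ 0 by rewrite /r_ take0.
  apply: runs_rep => k cnt' lt_k; pose v := Ordinal lt_k.
  have ev : nth v (enum 'I_n) k = v by exact: (nth_ord_enum v v).
  apply: runs_eq.
    apply: (@runs_vertex c n (row v) (tss_threshold v));
      rewrite ?size_set_code ?size_nseq //.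
    - exact: ltnW.
    - rewrite /i_ (drop_nth v) ?size_enum_ord // ev /= -catA; reflexivity.
  rewrite /r_ (take_nth v) ?size_enum_ord // ev map_rcons -cats1 flatten_cat rev_cat /=.
  by rewrite cats0 -catA.
apply: runs_eq; first exact: runs_push.
rewrite /i_ /r_ drop_oversize ?take_oversize ?size_enum_ord // /upd /get /=.
by rewrite rev_cat rev_cat /nat_code rev_rcons rev_nseq -catA.
Qed.

(** By [size_runs] the word in [ACC] is no longer than the time spent producing it, so reversing it
    into [OUT] costs at most four times that time plus 1. *)
Lemma runs_reduce : exists2 s',
  runs (reduce c) (tss_code I :: nseq 12 [::]) s' (5 * reduce_acc_time c n + 1)
  & get s' OUT = nat_code n ++ flatten [seq block v | v <- enum 'I_n] ++ [:: false].
Proof.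
have [y [v r]] := runs_reduce_acc; eexists.
  apply: (runs_le (runs_seq r _)).
    by apply: runs_move.
  have := size_runs ACC r; rewrite /get /=; lia.
by rewrite /get /upd /= catrevE revK cats0.
Qed.

End Reduce.

(** * Conversion of solutions *)

Definition drop_first : prg :=
  seqp (whilep IN top_true (seqp (pop IN) (pop IN)))
    (seqp (pop IN) (seqp (movep IN ACC) (movep ACC OUT))).

(** Since solutions are converted by the identity, it suffices to strip the instance from the pair.
    Two moves are made because each one reverses the word. *)
Lemma runs_drop_first u w : exists2 s',
  runs drop_first (pair_code u w :: nseq 12 [::]) s' (8 * size (pair_code u w) + 4)
  & get s' OUT = w.
Proof.
eexists.
  have sz : size (pair_code u w) = 2 * size u + (size w).+1.
    by rewrite size_cat /=; congr (_ + _); elim: u => //= b u ->; lia.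
  apply: (runs_le (t := (3 * size u + 1) + (1 + ((4 * size w + 1) + (4 * size w + 1)))));
    last by rewrite sz; lia.
  apply: (runs_seq (s2 := (false :: w) :: nseq 12 [::])).
    elim: u {sz} => [|b u IH]; first exact: runs_while_exit.
    apply: (runs_le (t := ((1 + 1) + (3 * size u + 1)).+1)); last by rewrite /=; lia.
    apply: runs_while_loop IH; first by [].
    by apply: runs_seq; exact: runs_pop.
  apply: runs_seq; first exact: runs_pop.
  apply: runs_seq; first exact: (runs_move (l := w)).
  by apply: (runs_le (runs_move (l := rev w) _ _ _)); rewrite ?size_rev //
    /get /upd /= catrevE cats0.
by rewrite /get /upd /= catrevE revK cats0.
Qed.

(** * The output as the code of the formula *)

Section Code.
Variables (c : nat) (I : tss_instance).
Local Notation n := (tss_order I).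

Lemma mask_inter_set_code z (v : 'I_n) : n <= size z ->
  mask_inter z (set_code (tss_neighbors v)) = set_code (masked_neighbors z v).
Proof.
move=> le_n; apply: (@eq_from_nth _ false) => [|k].
  by rewrite size_mask_inter !size_set_code.
rewrite size_mask_inter ?size_set_code // => lt_k.
rewrite (nth_map (false, false)) ?size2_zip ?size_set_code //.
rewrite nth_zip_cond size2_zip ?size_set_code // lt_k /=.
have ek : nth v (enum 'I_n) k = Ordinal lt_k by exact: (nth_ord_enum v (Ordinal lt_k)).
rewrite !(nth_map v) -?enumT ?size_enum_ord // ek !inE.
by rewrite andbC.
Qed.

(** Every word extends 0^n and so has length at least [n]; hence zipping it with a row loses no bit
    of the row. *)
Lemma horn_code_tss : horn_code (horn_of_tss c I) =
  nat_code n ++ flatten [seq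
    flatten [seq clause_word (set_code (tss_neighbors v)) (tss_threshold v) v z
            | z <- words n c (nseq n false)] | v <- enum 'I_n] ++ [:: false].
Proof.
rewrite /horn_code /= flatten_map_flatten; congr (_ ++ (flatten _ ++ _)).
apply: eq_map => v; have: all (fun z => n <= size z) (words n c (nseq n false)).
  by apply/allP=> z /words_size; rewrite size_nseq.
elim: (words _ _ _) => //= z s IH /andP[le_n /IH {}IH].
rewrite /clause_word mask_inter_set_code // count_set_code.
by case: leqP => _ /=; rewrite IH.
Qed.

End Code.

(** * Polynomial running time and the reduction *)

Lemma poly_bounded_gen_time k t : poly_bounded (fun n => gen_time k n t).
Proof.
elim: k => [|k IH] /=; repeat first [exact: IH | exact: poly_bounded_id
  | exact: poly_bounded_const | apply: poly_boundedD | apply: poly_boundedM].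
Qed.

Lemma poly_bounded_reduce_acc_time c : poly_bounded (reduce_acc_time c).
Proof.
rewrite /reduce_acc_time /vertex_time.
repeat first [exact: poly_bounded_gen_time | exact: poly_bounded_id
  | exact: poly_bounded_const | apply: poly_boundedD | apply: poly_boundedM].
Qed.

Theorem theorem8 (c : nat) :
  poly_reducible (@restrict min_TSS (thresholds_at_most c)) min_Key.
Proof.
have feasE (I : {I : tss_instance | thresholds_at_most c I})
    (S : {set 'I_(tss_order (sval I))}) :
    @key (horn_of_tss c (sval I)) S <-> target_set S.
  by apply: key_target_set; apply: svalP.
exists (fun I => horn_of_tss c (sval I)), (fun I s => s); split.
- apply: (@poly_time_runs _ _ _ 12 (reduce c) (fun n => 5 * reduce_acc_time c n + 1)).
    apply: poly_boundedD; last exact: poly_bounded_const.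
    by apply: poly_boundedM;
      [exact: poly_bounded_const | exact: poly_bounded_reduce_acc_time].
  move=> [I bI]; exists (tss_order I).
    (* The order is coded in unary, hence is at most the input length. *)
    by rewrite /= /tss_code size_cat size_rcons size_nseq; lia.
  have [s' r o] := runs_reduce bI; exists s' => //.
  (* [OUT] and [ord_max] have the same value but different bound proofs. *)
  by rewrite -[RHS]/(horn_code _) horn_code_tss -o; congr get; apply: val_inj.
- move=> I k; split=> -[[s fs cs] opt]; split.
  + by exists s => //; apply/feasE.
  + by move=> s' /feasE; apply: opt.
  + by exists s => //; apply/feasE.
  + by move=> s' /feasE; apply: opt.
- apply: (@poly_time_runs _ _ _ 12 drop_first (fun n => 8 * n + 4)).
    apply: poly_boundedD; last exact: poly_bounded_const.
    by apply: poly_boundedM; [exact: poly_bounded_const | exact: poly_bounded_id].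
  move=> z; eexists; first exact: leqnn.
  have [s' r o] := runs_drop_first (instance_code (tag z))
    (solution_code (sval (tagged z))).
  by exists s' => //; rewrite -o; congr get; apply: val_inj.
- by move=> I s /feasE.
Qed.
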